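(* Let $\alpha$ be an admissible assigning of a graph $G$. Then each unsigned coefficient $w_i(G,\alpha)$, $i=0,1,\ldots,r(G)$, of the cycle-assigning polynomial $P(G,\alpha;k)$ is a positive integer, unless $\alpha(e)=0$ for some loop $e$ of $G$. Moreover, $w_0(G,\alpha)=1$ whenever $P(G,\alpha;k)$ is not the zero polynomial.
   Context: Graphs are finite and may have loops and multiple edges; Abelian groups $A$ are additive and finite; $D$ is a fixed orientation of $G$. A cycle of $G$ is a connected 2-regular subgraph (a loop with its vertex is a cycle with one edge; two parallel edges form a cycle); $\mathcal{C}(G)$ is the set of cycles. An assigning of $G$ is a map $\alpha:\mathcal{C}(G)\to\{0,1\}$; for a loop $e$, $\alpha(e)$ is the value of $\alpha$ on the cycle formed by $e$. For each cycle $C$ fix one of its two directions $o(C)$ and define $\eta_{D(C)}:E(G)\to\{0,\pm1\}$ by $\eta_{D(C)}(e)=1$ if $e\in E(C)$ and the direction of $e$ under $D$ is consistent with $o(C)$, $-1$ if $e\in E(C)$ and the direction of $e$ is opposite to $o(C)$, and $0$ if $e\notin E(C)$. For $f:E(G)\to A$, set $\alpha_{D,f}(C)=0$ if $\sum_{e\in E(C)}\eta_{D(C)}(e)f(e)=0$ and $1$ otherwise. An assigning $\alpha$ is admissible if $\alpha=\alpha_{D,f}$ for some finite Abelian group $A$ and some $f:E(G)\to A$ (independent of $D$ and the $o(C)$). A subgraph $H$ of $G$ is $\alpha$-compatible if $\alpha(C)=0$ for every cycle $C$ of $H$. The cycle-assigning polynomial is $P(G,\alpha;k):=\sum_{H}(-1)^{|E(H)|}k^{c(H)}$,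 the sum over all $\alpha$-compatible spanning subgraphs $H$ of $G$ (spanning: $V(H)=V(G)$), where $c(H)$ is the number of components of $H$. With $r(G)=|V(G)|-c(G)$, the unsigned coefficients $w_i(G,\alpha)$ are defined by $P(G,\alpha;k)=\sum_{i=0}^{r(G)}(-1)^{i}w_i(G,\alpha)k^{|V(G)|-i}$. *)

(* Defs.v *)
From mathcomp Require Import all_boot all_order all_algebra.

Set Implicit Arguments.
Unset Strict Implicit.
Unset Printing Implicit Defensive.

Import GRing.Theory.
Local Open Scope ring_scope.

(* Loops are the edges whose two ends coincide; distinct edges may share their
   ends.  The order in the pair [ends e] carries no meaning of its own: it only
   serves to name the two ways in which [e] can be oriented. *)
Record multigraph := Multigraph {
  vertex : finType;
  edge : finType;
  ends : edge -> vertex * vertex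
}.

Section Multigraph.
Variable G : multigraph.

Definition is_loop (e : edge G) : bool := (ends e).1 == (ends e).2.

(* A vertex set and an edge set; a subgraph when [is_subgraph] holds. *)
Definition presubgraph : Type := ({set vertex G} * {set edge G})%type.
Implicit Types H C : presubgraph.

Definition is_subgraph H : bool :=
  [forall e in H.2, ((ends e).1 \in H.1) && ((ends e).2 \in H.1)].

Definition subgraph_of C H : bool := (C.1 \subset H.1) && (C.2 \subset H.2).

Definition whole : presubgraph := (setT, setT).

Definition adjacent H : rel (vertex G) :=
  [rel u v | [exists e in H.2, (ends e == (u, v)) || (ends e == (v, u))]].

Definition ncomp H : nat := n_comp (adjacent H) H.1.

(* A loop contributes 2. *)
Definition degree H (v : vertex G) : nat :=
  (#|[set e in H.2 | (ends e).1 == v]| +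
   #|[set e in H.2 | (ends e).2 == v]|)%N.

Definition is_cycle C : bool :=
  [&& is_subgraph C, ncomp C == 1%N & [forall v in C.1, degree C v == 2%N]].

Definition cycle_of : Type := {C : presubgraph | is_cycle C}.

Definition loop_subgraph (e : edge G) : presubgraph :=
  ([set (ends e).1], [set e]).

Lemma loop_subgraph_cycle (e : edge G) :
  is_loop e -> is_cycle (loop_subgraph e).
Proof.
move=> /eqP le; set v := (ends e).1.
have adjv x y : adjacent (loop_subgraph e) x y -> x = v /\ y = v.
  case/existsP => f; rewrite inE => /andP[/eqP -> ].
  by rewrite (surjective_pairing (ends e)) -le; case/orP => /eqP[<- <-].
apply/and3P; split.
- by apply/forall_inP => f /set1P->; rewrite -le !inE !eqxx.
- have vroot : fingraph.root (adjacent (loop_subgraph e)) v == v.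
    have /connectP[p pth E] := connect_root (adjacent (loop_subgraph e)) v.
    apply/eqP; rewrite {}E.
    case/lastP: p pth => [|q x] //; rewrite rcons_path last_rcons.
    by case/andP=> _ /adjv[].
  rewrite /ncomp /n_comp_mem (eq_card (B := pred1 v)) ?card1 // => x.
  by rewrite !inE andbC; case: eqP => // ->.
- apply/forall_inP => x /set1P->; rewrite /degree /=.
  have E (g : edge G -> vertex G) :
      g e = v -> [set f in [set e] | g f == v] = [set e].
    move=> ge; apply/setP => f; rewrite !inE.
    by case: eqP => [->|]; rewrite ?ge ?eqxx.
  by rewrite !E ?cards1.
Qed.

Definition loop_cycle (e : edge G) (le : is_loop e) : cycle_of :=
  exist _ (loop_subgraph e) (loop_subgraph_cycle le).

(* [true] orients [e] from the first to the second component of [ends e]. *)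
Definition orientation : Type := edge G -> bool.

Definition edge_tail (D : orientation) (e : edge G) : vertex G :=
  if D e then (ends e).1 else (ends e).2.

Definition edge_head (D : orientation) (e : edge G) : vertex G :=
  if D e then (ends e).2 else (ends e).1.

(* [o] traverses [C] in one of its two directions, i.e. it makes [C] a directed
   cycle; the values of [o] outside [C] are irrelevant. *)
Definition is_direction C (o : orientation) : bool :=
  [forall v in C.1, (#|[set e in C.2 | edge_tail o e == v]| == 1%N) &&
                    (#|[set e in C.2 | edge_head o e == v]| == 1%N)].

Definition eta (D : orientation) C (o : orientation) (e : edge G) : int :=
  if e \in C.2 then (if D e == o e then 1 else -1) else 0.

(* [false] stands for 0 and [true] for 1. *)
Definition assigning : Type := cycle_of -> bool.

Definition induced_assigning (D : orientation) (o : cycle_of -> orientation)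
    (A : finZmodType) (f : edge G -> A) : assigning :=
  fun C : cycle_of => \sum_(e in (val C).2) f e *~ eta D (val C) (o C) e != 0.

Definition admissible (D : orientation) (o : cycle_of -> orientation)
    (alpha : assigning) : Prop :=
  exists (A : finZmodType) (f : edge G -> A),
    forall C : cycle_of, alpha C = induced_assigning D o f C.

Definition compatible (alpha : assigning) H : bool :=
  [forall C : cycle_of, subgraph_of (val C) H ==> (alpha C == false)].

Definition cycle_assigning_poly (alpha : assigning) : {poly int} :=
  \sum_(H : presubgraph |
        [&& is_subgraph H, H.1 == setT & compatible alpha H])
     (-1) ^+ #|H.2| *: 'X^(ncomp H).

Definition rank_of : nat := (#|vertex G| - ncomp whole)%N.

Definition unsigned_coef (alpha : assigning) (i : nat) : int :=
  (-1) ^+ i * (cycle_assigning_poly alpha)`_(#|vertex G| - i)%N.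

Lemma adjacent_sym H : connect_sym (adjacent H).
Proof.
apply: sym_connect_sym => u v /=.
by apply: eq_existsb => e; rewrite orbC.
Qed.

Lemma ncomp_le H : (ncomp H <= #|vertex G|)%N.
Proof. exact: max_card. Qed.

Lemma ncomp_ge H : H.1 = setT -> (ncomp whole <= ncomp H)%N.
Proof.
move=> H1; rewrite /ncomp H1 /whole /=.
set r := adjacent H; set s := adjacent _.
have sub : subrel (connect r) (connect s).
  apply: connect_sub => u v /existsP[e /andP[_ He]]; apply: connect1.
  by apply/existsP; exists e; rewrite inE.
rewrite /n_comp_mem -(@card_in_imset _ _ (fingraph.root r)); last first.
  move=> u v; rewrite !inE !andbT => /eqP ru /eqP rv E.
  rewrite -ru -rv; apply/(fingraph.rootP (@adjacent_sym _)); apply: sub.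
  by apply/(fingraph.rootP (@adjacent_sym _)).
apply: subset_leq_card; apply/subsetP => _ /imsetP[u _ ->].
by rewrite !inE andbT; apply: roots_root; apply: adjacent_sym.
Qed.

(* [unsigned_coef] does collect all the coefficients. *)
Lemma cycle_assigning_polyE (alpha : assigning) :
  cycle_assigning_poly alpha =
  \sum_(0 <= i < rank_of.+1)
     ((-1) ^+ i * unsigned_coef alpha i) *: 'X^(#|vertex G| - i).
Proof.
have bnd j : (cycle_assigning_poly alpha)`_j != 0 ->
    (ncomp whole <= j <= #|vertex G|)%N.
  apply: contraR => out; rewrite coef_sum big1 // => H /and3P[_ /eqP H1 _].
  rewrite coefZ coefXn; case: eqP => [jE|]; last by rewrite mulr0.
  by rewrite jE ncomp_le ncomp_ge in out.
apply/polyP => j; rewrite [RHS]coef_sum big_mkord.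
under [RHS]eq_bigr => i _ do rewrite coefZ coefXn /unsigned_coef signrMK.
have rk (i : 'I_rank_of.+1) : (i <= #|vertex G|)%N.
  by apply: leq_trans (leq_subr (ncomp whole) _); rewrite -ltnS ltn_ord.
have [j0|/bnd/andP[cj jn]] := eqVneq ((cycle_assigning_poly alpha)`_j) 0.
  rewrite j0 big1 // => i _; case: eqP => [<-|]; last by rewrite mulr0.
  by rewrite j0 mul0r.
have ij : (#|vertex G| - j < rank_of.+1)%N by rewrite ltnS leq_sub2l.
rewrite (bigD1 (Ordinal ij)) //= subKn // eqxx mulr1 big1 ?addr0 // => i ne.
case: eqP => [jE|]; last by rewrite mulr0.
by case/eqP: ne; apply: val_inj; rewrite /= jE subKn.
Qed.

End Multigraph.

(* Main.v *)
Require Import Defs.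
From mathcomp Require Import all_boot all_order all_algebra.

Set Implicit Arguments.
Unset Strict Implicit.
Unset Printing Implicit Defensive.

Import GRing.Theory Num.Theory.
Local Open Scope ring_scope.

(** Let [f : edge G -> A] induce the assigning.  An edge set [S] contains only
cycles of zero [f]-sum exactly when [f] is, on [S], the coboundary
[p (head e) - p (tail e)] of some potential [p] on the vertices; such an [S] is
called balanced ([compatible_balanced]).  So the polynomial is the signed sum of
[X^c(S)] over the balanced edge sets, which is the characteristic polynomial of
the analogue over [A] of the affine arrangement of hyperplanes
[x_(head e) - x_(tail e) = f e].

The sign pattern comes from deletion and contraction.  Contracted graphs are
avoided by summing over the balanced sets that contain a fixed set [B], the
remaining edges being chosen in [E]: writing [F B E] for this sum ([charpoly]),
splitting on whether [e] is chosen gives [F B E = F B (E - e) - F (B + e) (E - e)]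
([charpolyD1]).  If an edge of [E] lies in the balanced closure of [B] (it joins
two vertices of one component of [B], and adding it keeps [B] balanced), then
adding or removing it changes neither balance nor components, and [F B E]
vanishes ([charpoly_degenerate]).  Otherwise each application of the
recurrence to an edge that lowers the number of components adds up terms of the
same sign, so the signs alternate ([charpoly_sign_ge0]); and no coefficient
between the two extreme degrees vanishes, because either deleting [e] keeps the
lower degree, or [e] is a bridge, and then contracting it creates no edge of the
balanced closure ([charpoly_sign_gt0]).

For [B] empty, an edge of the balanced closure is a loop [e] with
[alpha e = 0].  Without one, the only balanced set with as many components as
vertices is the empty one, whence the leading coefficient 1
([charpoly_lead]).

The recursion uses only five properties of balance, of connection by a set of
edges and of the number of components, and is carried out for any finite
structure that has them, a semimatroid. *)

(** * Semimatroids and their characteristic polynomials *)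

(** The combinatorics of an affine hyperplane arrangement: [central] sets are
those with a common point, [corank] is the dimension of the intersection of the
linear parts, and [spans S e] says that the linear form of [e] is a combination
of those of [S].  The last two axioms say when a hyperplane meets a nonempty
intersection of others: always if its linear form is not spanned by
theirs; and if it is spanned by those of a subset [S] of them, as soon as the
hyperplane meets, hence contains, the intersection of [S]. *)
Record semimatroid (T : finType) := Semimatroid {
  central : pred {set T};
  spans : {set T} -> pred T;
  corank : {set T} -> nat;
  spansS : forall (S S' : {set T}) e, S \subset S' -> spans S e -> spans S' e;
  corankU1 : forall S e, corank S = (corank (e |: S) + ~~ spans S e)%N;
  centralS : forall S S' : {set T}, S \subset S' -> central S' -> central S;
  central_spanned : forall (S S' : {set T}) e,
    S \subset S' -> spans S e -> central (e |: S) -> central S' ->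
    central (e |: S');
  central_unspanned : forall S e, ~~ spans S e -> central S -> central (e |: S)
}.

Section CharPoly.
Variables (T : finType) (M : semimatroid T).
Implicit Types (B E S : {set T}) (e : T).

(** Up to a sign [(-1)^|B|], the part of the sum over the central subsets of
[B :|: E] that comes from those containing [B] (for [B] and [E] disjoint): it
stands for the characteristic polynomial after contraction of [B]. *)
Definition charpoly B E : {poly int} :=
  \sum_(S : {set T} | (S \subset E) && central M (B :|: S))
     (-1) ^+ #|S| *: 'X^(corank M (B :|: S)).

(** No element of [E] becomes a central loop once [B] is contracted. *)
Definition simple_over B E : Prop :=
  forall e, e \in E -> central M (e |: B) -> ~~ spans M B e.

Lemma corank_subset S S' : S \subset S' -> (corank M S' <= corank M S)%N.
Proof.
move=> sS.
have [n] := ubnP #|S' :\: S|; elim: n => // n IHn in S sS *; rewrite ltnS => le_n.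
have [D0|[e De]] := set_0Vmem (S' :\: S).
  suff -> : S = S' by [].
  by apply/eqP; rewrite eqEsubset sS /= -setD_eq0 D0.
rewrite (corankU1 M S e); apply: leq_trans (leq_addr _ _).
have /setDP[S'e Se] := De.
apply: IHn; first by rewrite subUset sub1set S'e.
apply: leq_trans le_n; apply: proper_card; rewrite properE.
rewrite setDS ?subsetUr //=.
by apply/subsetPn; exists e => //; rewrite !inE eqxx.
Qed.

Lemma charpoly0 B :
  charpoly B set0 = if central M B then 'X^(corank M B) else 0.
Proof.
rewrite /charpoly (eq_bigl (fun S => central M B && (S == set0))); last first.
  move=> S; rewrite subset0 andbC; case: eqP => [->|_]; last by rewrite !andbF.
  by rewrite setU0.
case: ifP => _; last by rewrite big_pred0.
by rewrite big_pred1_eq cards0 setU0 scale1r.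
Qed.

(** Deletion-contraction.  When [e |: B] is not central the second term is an
empty sum, and the equation says that [e] can be deleted. *)
Lemma charpolyD1 B E e : e \in E ->
  charpoly B E = charpoly B (E :\ e) - charpoly (e |: B) (E :\ e).
Proof.
move=> Ee; rewrite /charpoly (bigID (fun S => e \notin S)) /=; congr (_ + _).
  by apply: eq_bigl => S; rewrite subsetD1 andbAC.
rewrite -sumrN.
rewrite (reindex_onto (fun S => e |: S) (fun S => S :\ e)) /=; last first.
  by move=> S /andP[_ /negPn/setD1K].
apply: eq_big => [S|S /andP[/andP[/andP[_ _] _] /eqP SeS]].
  rewrite subUset sub1set Ee setU11 !andbT /= subsetD1 setUCA setUA.
  have [eS|eS] := boolP (e \in S).
    rewrite andbF; apply/negP=> /andP[_ /eqP SE].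
    by have := setD11 e (e |: S); rewrite SE eS.
  by rewrite setU1K // eqxx !andbT.
have eS : e \notin S by rewrite -SeS setD11.
by rewrite cardsU1 eS exprS mulN1r scaleNr setUCA setUA.
Qed.

Lemma charpoly_uncentral B E : ~~ central M B -> charpoly B E = 0.
Proof.
move=> ncB; rewrite /charpoly big_pred0 // => S.
apply/negbTE; rewrite negb_and orbC; apply/orP; left.
by apply: contra ncB; apply: centralS; apply: subsetUl.
Qed.

(** Adding [e] to a set that contains [B] preserves centrality and corank, so
the two terms of the deletion-contraction formula are equal. *)
Lemma charpoly_degenerate B E e :
  e \in E -> spans M B e -> central M (e |: B) -> charpoly B E = 0.
Proof.
move=> Ee sBe ceB; rewrite (charpolyD1 _ Ee); apply/eqP; rewrite subr_eq0.
apply/eqP; apply: eq_big => [S|S _]; rewrite -setUA.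
  congr (_ && _); apply/idP/idP; last by apply: centralS; apply: subsetUr.
  by apply: central_spanned sBe ceB; apply: subsetUl.
by rewrite (corankU1 M (B :|: S) e) (spansS _ sBe) ?subsetUl ?addn0.
Qed.

(** Since [corank B + j] and [corank B - j] have the same parity, the sign is
the expected one for the coefficient of degree [j]; written this way it makes
sense for every [j], and it flips when [B] grows by an element that it does not
span, which cancels the minus sign of deletion-contraction.  An element that [B]
does span gives either a degenerate sum or a contraction that is an empty sum.
*)
Lemma charpoly_sign_ge0 B E j :
  0 <= (-1) ^+ (corank M B + j) * (charpoly B E)`_j.
Proof.
have [n] := ubnP #|E|; elim: n => // n IHn in B E *; rewrite ltnS => le_n.
have [->|[e Ee]] := set_0Vmem E.
  rewrite charpoly0; case: ifP => _; last by rewrite coef0 mulr0.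
  rewrite coefXn; case: eqP => [->|_]; last by rewrite mulr0.
  by rewrite mulr1 exprD -expr2 sqrr_sign.
have ltE : (#|E :\ e| < n)%N by rewrite (cardsD1 e) Ee in le_n.
have [sBe|sBe] := boolP (spans M B e).
  have [ceB|ceB] := boolP (central M (e |: B)).
    by rewrite (charpoly_degenerate Ee) // coef0 mulr0.
  by rewrite (charpolyD1 _ Ee) (charpoly_uncentral _ ceB) subr0 IHn.
rewrite (charpolyD1 _ Ee) coefB mulrBr addr_ge0 ?IHn //.
by rewrite (corankU1 M B e) sBe addn1 addSn exprS mulN1r mulNr opprK IHn.
Qed.

(** If deleting [e] preserves the corank of [B :|: E], then the deletion term is
positive.  Otherwise [e] is not spanned by the other elements, and the
contraction term is positive provided that [e |: B] remains simple: a new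
central loop [e'] would be spanned by [e |: B] but not by [B], hence by exchange
[e] would be spanned by [e' |: B]. *)
Lemma charpoly_sign_gt0 B E j :
    central M B -> simple_over B E ->
    (corank M (B :|: E) <= j <= corank M B)%N ->
  0 < (-1) ^+ (corank M B + j) * (charpoly B E)`_j.
Proof.
have [n] := ubnP #|E|; elim: n => // n IHn in B E *; rewrite ltnS => le_n.
move=> cB simE.
have [->|[e Ee]] := set_0Vmem E.
  rewrite setU0 charpoly0 cB -eqn_leq coefXn => /eqP ->.
  by rewrite eqxx mulr1 exprD -expr2 sqrr_sign.
have ltE : (#|E :\ e| < n)%N by rewrite (cardsD1 e) Ee in le_n.
case/andP => lej jle; rewrite (charpolyD1 _ Ee) coefB mulrBr.
have BE : e |: (B :|: (E :\ e)) = B :|: E by rewrite setUCA setD1K.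
have simD : simple_over B (E :\ e) by move=> e' /setD1P[_]; apply: simE.
have [lej'|ltj] := leqP (corank M (B :|: (E :\ e))) j.
  apply: ltr_pwDl; first by rewrite IHn // lej'.
  have [sBe|sBe] := boolP (spans M B e).
    rewrite (charpoly_uncentral (B := e |: B)) ?coef0 ?mulr0 ?oppr0 //.
    by apply: contraTN sBe => /simE->.
  rewrite (corankU1 M B e) sBe addn1 addSn exprS mulN1r mulNr opprK.
  exact: charpoly_sign_ge0.
(* Deleting e raises the corank of B :|: E above j, so e is a coloop. *)
have sBEe : ~~ spans M (B :|: (E :\ e)) e.
  apply: contraL ltj => s; rewrite -leqNgt.
  by rewrite (corankU1 M _ e) s addn0 BE.
have sBe : ~~ spans M B e by apply: contra sBEe; apply: spansS; apply: subsetUl.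
apply: ltr_wpDl; first exact: charpoly_sign_ge0.
have cBe := corankU1 M B e; rewrite sBe addn1 in cBe.
rewrite cBe addSn exprS mulN1r mulNr opprK IHn //.
- exact: central_unspanned.
- move=> e' De' ce'; have /setD1P[_ Ee'] := De'.
  have sBe' : ~~ spans M B e'.
    apply: simE => //; apply: centralS ce'.
    by rewrite setUS // subsetUr.
  apply: contra sBEe => se'; apply: (@spansS _ M (e' |: B)).
    by rewrite subUset subsetUl sub1set inE De' orbT.
  (* Exchange: compare the two ways of adding e and e' to B. *)
  have := corankU1 M (e' |: B) e; have := corankU1 M (e |: B) e'.
  have := corankU1 M B e'; rewrite se' (negbTE sBe') cBe addn0 addn1 setUCA.
  by case=> <- <-; case: spans => //; rewrite addn1 => /n_Sn.
- rewrite -setUA BE lej /= -ltnS -cBe; apply: leq_trans ltj _.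
  exact/corank_subset/subsetUl.
Qed.

(** Any nonempty [S] that contributes in the top degree has the corank of [B],
so its elements are spanned by [B], against simplicity. *)
Lemma charpoly_lead B E :
  central M B -> simple_over B E -> (charpoly B E)`_(corank M B) = (1 : int).
Proof.
move=> cB simE; rewrite coef_sum (bigD1 set0) /=; last by rewrite sub0set setU0.
rewrite setU0 cards0 scale1r coefXn eqxx big1 ?addr0 // => S.
case/andP => /andP[/subsetP sSE cS] /set0Pn[e Se].
rewrite coefZ coefXn; case: eqP => [cE|]; last by rewrite mulr0.
have sub : e |: B \subset B :|: S.
  by rewrite subUset sub1set inE Se orbT subsetUl.
have /negP[] := simE e (sSE e Se) (centralS sub cS).
have := corank_subset sub; rewrite -cE (corankU1 M B e).
by case: spans; rewrite // addn1 ltnn.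
Qed.

End CharPoly.

(** * Connection and components *)

Section Graph.
Variable G : multigraph.
Implicit Types (S : {set edge G}) (e : edge G) (D : orientation G).

Definition joined S e : bool :=
  connect (adjacent (setT, S)) (ends e).1 (ends e).2.

Lemma adjacent_ends (V : {set vertex G}) S e :
  e \in S -> adjacent (V, S) (ends e).1 (ends e).2.
Proof.
by move=> Se; apply/existsP; exists e; rewrite -surjective_pairing eqxx andbT.
Qed.

Lemma adjacentP (V : {set vertex G}) S u v :
  reflect (exists2 e, e \in S & ends e = (u, v) \/ ends e = (v, u))
          (adjacent (V, S) u v).
Proof.
apply: (iffP existsP) => [[e /andP[Se ue]] | [e Se ue]]; exists e => //.
  by case/orP: ue => /eqP; [left | right].
by rewrite Se; case: ue => ->; rewrite eqxx ?orbT.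
Qed.

Lemma sub_connect_adjacent S S' : S \subset S' ->
  subrel (connect (adjacent (setT, S))) (connect (adjacent (setT, S'))).
Proof.
move=> /subsetP sS; apply: connect_sub => u v /adjacentP[e Se ue].
by apply/connect1/adjacentP; exists e; rewrite ?sS.
Qed.

Lemma joinedS S S' e : S \subset S' -> joined S e -> joined S' e.
Proof. by move=> sS; apply: sub_connect_adjacent. Qed.

Lemma connect_adjacent_const S (T : Type) (g : vertex G -> T) u v :
    (forall e, e \in S -> g (ends e).1 = g (ends e).2) ->
  connect (adjacent (setT, S)) u v -> g u = g v.
Proof.
move=> gS /connectP[p pth ->]; elim: p u pth => //= w p IHp u.
case/andP => /adjacentP[e Se ue] /IHp <-.
by have := gS e Se; case: ue => ->.
Qed.

(** Let [a] be the union of the components of the two ends of [e].  It is closed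
for both adjacency relations, which agree outside [a]; inside [a] there is one
component with [e], and one or two without. *)
Lemma ncompU1 S e :
  ncomp (setT, S) = (ncomp (setT, e |: S) + ~~ joined S e)%N.
Proof.
set r := adjacent (setT, S); set r' := adjacent (setT, e |: S).
have sr : connect_sym r := @adjacent_sym G _.
have sr' : connect_sym r' := @adjacent_sym G _.
have ncT (R : rel (vertex G)) : n_comp R [set: vertex G] = n_comp R (vertex G).
  by apply: eq_n_comp_r => x; rewrite inE.
rewrite /ncomp -/r -/r' !ncT /=.
pose x := (ends e).1; pose y := (ends e).2; pose a := closure r (pred2 x y).
have a_x : x \in a by apply: mem_closure; rewrite !inE eqxx.
have a_y : y \in a by apply: mem_closure; rewrite !inE eqxx orbT.
have rE u v : u \notin a -> r' u v = r u v.
  move=> a_u; apply/adjacentP/adjacentP => -[f Sf uf]; exists f => //.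
    case/setU1P: Sf uf => // ->; rewrite (surjective_pairing (ends e)).
    by case=> -[E1 E2]; rewrite -?E1 -?E2 ?a_x ?a_y in a_u.
  by rewrite inE Sf orbT.
have cl_a : closed r a := closure_closed sr _.
have cl_a' : closed r' a.
  apply: (intro_closed sr') => u v ruv a_u; have [//|a_v] := boolP (v \in a).
  have rvu : r v u.
    rewrite -rE //; move: ruv => /adjacentP[f Sf uf]; apply/adjacentP.
    by exists f => //; case: uf; [right | left].
  by rewrite (cl_a v u rvu) a_u in a_v.
rewrite (n_compC a r) (n_compC a r').
have -> : n_comp r' a = 1%N.
  rewrite (@eq_n_comp_r _ r' a (closure r' (pred2 x y))).
    by rewrite n_comp_closure2 // connect1 //; apply/adjacent_ends/setU11.
  move=> z; apply/idP/idP.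
    case/existsP => t /andP[/= zt txy]; apply/existsP; exists t.
    rewrite /= txy andbT.
    by apply: sub_connect_adjacent zt; apply: subsetUr.
  case/existsP => t /andP[/= /(closed_connect cl_a') -> ].
  by case/pred2P => ->.
have -> : n_comp r' [predC a] = n_comp r [predC a].
  apply: (@adjunction_n_comp _ _ id) => //.
    exact: predC_closed.
  apply: strict_adjunction => //.
  - exact: predC_closed.
  - by apply/subsetP => z _; apply: codom_f.
  - by move=> u v /negPn; apply: rE.
by rewrite n_comp_closure2 // addnAC add1n.
Qed.

End Graph.

(** * Closing a path into a cycle *)

Section Cycle.
Variable G : multigraph.
Implicit Types (S F : {set edge G}) (e : edge G) (D : orientation G).

Lemma degreeU1 (V V' : {set vertex G}) F e x : e \notin F ->
  degree (V, e |: F) x =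
  (degree (V', F) x + (((ends e).1 == x) + ((ends e).2 == x)))%N.
Proof.
move=> Fe; rewrite /degree /= addnACA.
have cardE (g : edge G -> vertex G) :
    #|[set h in e |: F | g h == x]| =
    (#|[set h in F | g h == x]| + (g e == x))%N.
  rewrite (cardsD1 e) !inE eqxx /= addnC; congr (#|pred_of_set _| + _)%N.
  apply/setP => h; rewrite !inE; case: (eqVneq h e) => [->|] //=.
  by rewrite (negbTE Fe).
by rewrite !cardE.
Qed.

(** The degree equation says that inner vertices have degree 2 and the two ends
degree 1, or 0 if the path is reduced to a point; this form, uniform in all
vertices, is the one that survives adding an edge at the start of the path. *)
Lemma uniq_path_edges S u p :
    path (adjacent (setT, S)) u p -> uniq (u :: p) ->
  exists F : {set edge G},
    [/\ F \subset S,
        forall e, e \in F -> ((ends e).1 \in u :: p) && ((ends e).2 \in u :: p),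
        forall x, (degree (setT, F) x + ((x == u) + (x == last u p)) =
                   (x \in u :: p).*2)%N &
        forall x, x \in u :: p -> connect (adjacent (setT, F)) u x].
Proof.
elim: p u => [|w p IHp] u /=.
  move=> _ _; exists set0; split; first exact: sub0set.
  - by move=> e; rewrite inE.
  - move=> x; rewrite /degree /= !eq_card0 ?mem_seq1 ?addnn // => e.
      by rewrite !inE.
    by rewrite !inE.
  - by move=> x; rewrite mem_seq1 => /eqP ->; apply: connect0.
case/andP => /adjacentP[e Se ue] pth /andP[wpu upth].
have [F [FS Fends Fdeg Fconn]] := IHp w pth upth.
have Fe : e \notin F.
  apply: contra wpu => /Fends.
  by case: ue => -> /andP[].
exists (e |: F); split.
- by rewrite subUset sub1set Se.
- move=> h /setU1P[->|/Fends/andP[h1 h2]].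
    by case: ue => ->; rewrite !inE !eqxx ?orbT.
  by rewrite !(in_cons u) h1 h2 !orbT.
- move=> x; rewrite (degreeU1 _ setT) //.
  have -> : (((ends e).1 == x) + ((ends e).2 == x))%N = ((x == u) + (x == w))%N.
    by case: ue => -> /=; rewrite ![_ == x]eq_sym // addnC.
  rewrite -addnA addnACA addnCA Fdeg addnn (in_cons u).
  by case: (eqVneq x u) => [->|_]; rewrite ?(negbTE wpu) ?addn0.
- move=> x; rewrite in_cons => /predU1P[->|wx]; first exact: connect0.
  apply: (@connect_trans _ _ w).
    by apply/connect1/adjacentP; exists e; rewrite ?setU11.
  by apply: (sub_connect_adjacent (subsetUr [set e] F)); apply: Fconn.
Qed.

(** A simple path in [S] between the ends of [e], closed by [e]; the two ends
then gain the degree that they lack.  If [e] is a loop, the path is a point. *)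
Lemma cycle_through S e : e \notin S -> joined S e ->
  exists C : cycle_of G, e \in (val C).2 /\ (val C).2 \subset e |: S.
Proof.
move=> Se /connectP[q qpth qlast].
case/shortenP: qpth qlast => p pth up _ lastp.
have [F [FS Fends Fdeg Fconn]] := uniq_path_edges pth up.
set u := (ends e).1 in pth up lastp Fends Fdeg Fconn.
pose V := [set x in u :: p]; pose C : presubgraph G := (V, e |: F).
have Fe : e \notin F by apply: contra Se; apply: subsetP.
have subC : is_subgraph C.
  apply/forall_inP => h; rewrite !inE -!in_cons => /predU1P[->|/Fends //].
  by rewrite lastp mem_last mem_head.
have cycC : is_cycle C.
  apply/and3P; split=> //.
    rewrite /ncomp /= (@eq_n_comp_r _ _ _ (connect (adjacent C) u)).
      by rewrite n_comp_connect //; apply: adjacent_sym.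
    have clV : closed (adjacent C) V.
      apply: (intro_closed (@adjacent_sym G C)) => y z /adjacentP[h Ch yz] _.
      by have /andP := forall_inP subC h Ch; case: yz => -> [].
    move=> x; apply/idP/idP => [|/(closed_connect clV) <-].
      by rewrite inE => /Fconn; apply: sub_connect_adjacent; apply: subsetUr.
    by rewrite inE mem_head.
  apply/forall_inP => x; rewrite inE => px.
  rewrite (degreeU1 V setT) // lastp ![_ == x]eq_sym Fdeg px.
  by [].
exists (exist _ C cycC) => /=; rewrite setU11; split=> //.
exact: setUS.
Qed.

End Cycle.

(** * Potentials and balance *)

Section Gain.
Variables (G : multigraph) (D : orientation G) (A : finZmodType).
Implicit Types (S : {set edge G}) (e : edge G) (p : vertex G -> A).

Definition coboundary (o : orientation G) p e : A :=
  p (edge_head o e) - p (edge_tail o e).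

Lemma coboundary_eq0 p e :
  (coboundary D p e == 0) = (p (ends e).1 == p (ends e).2).
Proof.
by rewrite subr_eq0 /edge_head /edge_tail; case: (D e); rewrite // eq_sym.
Qed.

Lemma joined_coboundary_eq0 S p e :
    (forall h, h \in S -> coboundary D p h = 0) -> joined S e ->
  coboundary D p e = 0.
Proof.
move=> pS Se; apply/eqP; rewrite coboundary_eq0; apply/eqP.
apply: connect_adjacent_const Se => h /pS/eqP.
by rewrite coboundary_eq0 => /eqP.
Qed.

Lemma coboundaryB p q e :
  coboundary D (fun v => p v - q v) e = coboundary D p e - coboundary D q e.
Proof. by rewrite /coboundary !opprD !opprK addrACA. Qed.

Variable f : edge G -> A.

Definition balanced S : bool :=
  [exists p : {ffun vertex G -> A}, forall e in S, f e == coboundary D p e].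

Lemma balancedP S :
  reflect (exists p, forall e, e \in S -> f e = coboundary D p e) (balanced S).
Proof.
apply: (iffP existsP) => [[p /forall_inP pS] | [p pS]].
  by exists p => e /pS/eqP.
exists (finfun p); apply/forall_inP => e /pS ->.
by rewrite /coboundary !ffunE.
Qed.

Lemma balancedS S S' : S \subset S' -> balanced S' -> balanced S.
Proof.
by move=> /subsetP sS /balancedP[p pS']; apply/balancedP; exists p => e /sS/pS'.
Qed.

(** Two potentials of [S] differ by a constant on each component of [S], so they
have the same coboundary on an edge that [S] joins. *)
Lemma balanced_joined S S' e :
    S \subset S' -> joined S e -> balanced (e |: S) -> balanced S' ->
  balanced (e |: S').
Proof.
move=> /subsetP sS Se /balancedP[p pS] /balancedP[q qS'].
apply/balancedP; exists q.
move=> h /setU1P[->|/qS' //]; apply/eqP; rewrite pS ?setU11 // -subr_eq0.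
rewrite -coboundaryB; apply/eqP; apply: joined_coboundary_eq0 Se => {}h Sh.
by rewrite coboundaryB -pS ?inE ?Sh ?orbT // -qS' ?subrr // sS.
Qed.

(** The ends of [e] lie in distinct components of [S], so the potential can be
shifted by a constant on the component of the head. *)
Lemma balanced_unjoined S e : ~~ joined S e -> balanced S -> balanced (e |: S).
Proof.
move=> Se /balancedP[p pS]; apply/balancedP.
pose c := f e - coboundary D p e.
pose near_head := connect (adjacent (setT, S)) (edge_head D e).
pose q v := p v + c *+ near_head v.
have qE h : coboundary D q h = coboundary D p h +
    (c *+ near_head (edge_head D h) - c *+ near_head (edge_tail D h)).
  by rewrite /coboundary /q opprD addrACA.
have adj_sym := @adjacent_sym G (setT, S).
exists q => h; rewrite qE => /setU1P[->|Sh].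
  have -> : near_head (edge_head D e) by apply: connect0.
  have /negbTE -> : ~~ near_head (edge_tail D e).
    apply: contra Se; rewrite /near_head /edge_head /edge_tail /joined.
    by case: (D e); rewrite // adj_sym.
  by rewrite subr0 /c addrC subrK.
suff -> : near_head (edge_head D h) = near_head (edge_tail D h).
  by rewrite subrr addr0 pS.
rewrite /near_head ![connect _ (edge_head D e) _]adj_sym.
apply: (same_connect adj_sym); apply: connect1.
have := adjacent_ends setT Sh; rewrite /edge_head /edge_tail.
case: (D h) => // _; apply/adjacentP.
by exists h; rewrite // -surjective_pairing; right.
Qed.

Definition gain_semimatroid : semimatroid (edge G) :=
  Semimatroid (@joinedS G) (@ncompU1 G) balancedS balanced_joined
    balanced_unjoined.

(** In a directed cycle each vertex is the head of one edge and the tail of one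
edge, so the sum of a coboundary telescopes. *)
Lemma cycle_coboundary_sum C (o : orientation G) p :
    is_subgraph C -> is_direction C o -> \sum_(e in C.2) coboundary o p e = 0.
Proof.
move=> /forall_inP subC /forall_inP dirC.
have once (g : edge G -> vertex G) : (forall e, e \in C.2 -> g e \in C.1) ->
    (forall v, v \in C.1 -> #|[set e in C.2 | g e == v]| = 1%N) ->
    \sum_(e in C.2) p (g e) = \sum_(v in C.1) p v.
  move=> gC g1; rewrite (partition_big g [in C.1]) //=.
  apply: eq_bigr => v Cv; rewrite -[RHS]mulr1n -(g1 v Cv) -sumr_const.
  rewrite [RHS](eq_bigl (fun e => (e \in C.2) && (g e == v))).
    by apply: eq_bigr => e /andP[_ /eqP ->].
  by move=> e; rewrite inE.
rewrite /coboundary sumrB !once ?subrr //.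
- by move=> e /subC/andP[]; rewrite /edge_tail; case: (o e).
- by move=> v /dirC/andP[/eqP].
- by move=> e /subC/andP[]; rewrite /edge_head; case: (o e).
- by move=> v /dirC/andP[_ /eqP].
Qed.

Lemma coboundary_eta (C : presubgraph G) (o : orientation G) p e : e \in C.2 ->
  coboundary D p e *~ eta D C o e = coboundary o p e.
Proof.
move=> Ce; rewrite /eta Ce /coboundary /edge_head /edge_tail.
by case: (D e); case: (o e); rewrite //= mulrN1z opprB.
Qed.

Variable o : cycle_of G -> orientation G.
Hypothesis o_dir : forall C : cycle_of G, is_direction (val C) (o C).

(** Changing the gains by a coboundary changes no cycle sum.  Choosing the
potential so that all edges but one get gain 0 makes the sum a single term. *)
Lemma cycle_sum_gauge (C : cycle_of G) p :
  \sum_(e in (val C).2) f e *~ eta D (val C) (o C) e =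
  \sum_(e in (val C).2) (f e - coboundary D p e) *~ eta D (val C) (o C) e.
Proof.
have /and3P[subC _ _] := valP C.
under [RHS]eq_bigr => e Ce do rewrite mulrzBl coboundary_eta //.
by rewrite sumrB cycle_coboundary_sum ?subr0.
Qed.

(** Conversely to telescoping, let all cycles of [S] have zero sum and let [p]
be a potential of [S] without an edge [e].  If that set joins the ends of [e],
there is a cycle in [S] through [e]; after the change of gains by [p] its sum is
the gain of [e] up to sign, so [p] is right for [e] too.  If not, the potential
can be extended to [e] by [balanced_unjoined]. *)
Lemma compatible_balanced (alpha : assigning G) S :
    (forall C, alpha C = induced_assigning D o f C) ->
  compatible alpha (setT, S) = balanced S.
Proof.
move=> alphaE; apply/idP/idP; last first.
  case/balancedP=> p pS; apply/forallP => C.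
  apply/implyP => /andP[_ /= /subsetP CS].
  rewrite alphaE /induced_assigning (cycle_sum_gauge C p) big1 ?eqxx // => e Ce.
  by rewrite pS ?subrr ?mul0rz // CS.
have [n] := ubnP #|S|; elim: n => // n IHn in S *; rewrite ltnS => le_n compS.
have [->|[e Se]] := set_0Vmem S.
  by apply/balancedP; exists (fun=> 0) => e; rewrite inE.
have balD : balanced (S :\ e).
  apply: IHn; first by rewrite (cardsD1 e) Se in le_n.
  apply/forallP => C; apply/implyP => /andP[C1 /= C2].
  apply: (implyP (forallP compS C)); rewrite /subgraph_of C1 /=.
  by apply: subset_trans C2 (subsetDl _ _).
have [jDe|jDe] := boolP (joined (S :\ e) e); last first.
  by rewrite -(setD1K Se); apply: balanced_unjoined.
have [|C [Ce CS]] := cycle_through _ jDe; first by rewrite setD11.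
rewrite setD1K // in CS; case/balancedP: balD => p pD.
apply/balancedP; exists p => h Sh.
have [->{h Sh}|he] := eqVneq h e; last by rewrite pD // !inE he.
have := implyP (forallP compS C); rewrite /subgraph_of subsetT CS => /(_ isT).
rewrite alphaE /induced_assigning (cycle_sum_gauge C p) (bigD1 e) //=.
rewrite big1 => [|h /andP[Ch he]]; last first.
  by rewrite pD ?subrr ?mul0rz // !inE he (subsetP CS).
rewrite addr0 eqbF_neg negbK /eta Ce; case: ifP => _.
  by rewrite mulr1z subr_eq0 => /eqP.
by rewrite mulrN1z oppr_eq0 subr_eq0 => /eqP.
Qed.

Lemma cycle_assigning_poly_charpoly (alpha : assigning G) :
    (forall C, alpha C = induced_assigning D o f C) ->
  cycle_assigning_poly alpha = charpoly gain_semimatroid set0 setT.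
Proof.
move=> alphaE; rewrite /cycle_assigning_poly /charpoly.
rewrite (reindex_onto (fun S : {set edge G} => (setT, S)) snd) /=; last first.
  by case=> V S /and3P[_ /= /eqP -> _].
apply: eq_big => [S|S _]; last by rewrite set0U.
rewrite !eqxx subsetT set0U (compatible_balanced _ alphaE) andbT /=.
suff -> : is_subgraph ([set: vertex G], S) by [].
by apply/forall_inP => e _; rewrite !inE.
Qed.

End Gain.

(** * Coefficients of the cycle-assigning polynomial *)

Lemma ncomp0 (G : multigraph) : ncomp (G := G) (setT, set0) = #|vertex G|.
Proof.
rewrite /ncomp /n_comp_mem; apply: eq_card => x; rewrite !inE andbT.
have := connect_root (adjacent (setT, set0)) x.
case/connectP => -[_ rx|y p /= /andP[/adjacentP[e]]]; first by apply/eqP.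
by rewrite inE.
Qed.

Lemma joined0 (G : multigraph) (e : edge G) : joined set0 e = is_loop e.
Proof.
apply/connectP/eqP => [[[_ -> //|y p /= /andP[/adjacentP[h]]]]|->].
  by rewrite inE.
by exists [::].
Qed.

Theorem corollary5p2 (G : multigraph)
    (D : orientation G) (o : cycle_of G -> orientation G)
    (o_dir : forall C : cycle_of G, is_direction (val C) (o C))
    (alpha : assigning G) (alpha_adm : admissible D o alpha) :
  (~ (exists (e : edge G) (le : is_loop e), alpha (loop_cycle le) = false) ->
   forall i : nat, (i <= rank_of G)%N -> 0 < unsigned_coef alpha i) /\
  (cycle_assigning_poly alpha != 0 -> unsigned_coef alpha 0 = 1).
Proof.
case: alpha_adm => A [f alphaE]; pose M := gain_semimatroid D f.
have PE := cycle_assigning_poly_charpoly o_dir alphaE.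
have cM0 : corank M set0 = #|vertex G| by apply: ncomp0.
have bal0 : central M set0.
  by apply/balancedP; exists (fun=> 0) => e; rewrite inE.
split=> [no_loop i le_i | P_neq0].
  have simple : simple_over M set0 setT.
    move=> e _; rewrite setU0 /= joined0 => bal_e.
    apply/negP => le; case: no_loop.
    exists e, le; rewrite -(compatible_balanced o_dir [set e] alphaE) in bal_e.
    by apply/eqP; apply: (implyP (forallP bal_e _));
       rewrite /subgraph_of subsetT /=.
  have cE : corank M (set0 :|: setT) = ncomp (whole G) by rewrite set0U.
  have le_c : (ncomp (whole G) <= #|vertex G|)%N := ncomp_le _.
  have le_iV : (i <= #|vertex G|)%N by apply: leq_trans le_i (leq_subr _ _).
  have := @charpoly_sign_gt0 _ M set0 setT (#|vertex G| - i) bal0 simple.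
  (* |V| + (|V| - i) has the parity of i. *)
  rewrite cE cM0 leq_subr andbT leq_subRL // addnC -leq_subRL // => /(_ le_i).
  rewrite /unsigned_coef PE -{1}(subnK le_iV) addnAC exprD addnn -muln2 exprM.
  by rewrite sqrr_sign mul1r.
rewrite /unsigned_coef subn0 expr0 mul1r PE -cM0; apply: charpoly_lead => //.
move=> e Ee ce; apply: contra P_neq0 => sp.
by rewrite PE (charpoly_degenerate Ee sp ce).
Qed.
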